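(* Assume the PRIS-ARIS-NOMA model described in the context, with imperfect successive interference cancellation (ipSIC), and $a_m>\gamma_{th_m}a_n$. Let $$P_{D_n}^{out,ipSIC}(P_s^a)=\Pr\left(\gamma_{D_n}^{D_m}<\gamma_{th_m}\right)+\Pr\left(\gamma_{D_n}^{D_m}>\gamma_{th_m},\ \gamma_{D_n}<\gamma_{th_n}\right)$$ be the outage probability of the nearby user $D_n$ at transmit power $P_s^a$. Then, with all other parameters fixed, $P_{D_n}^{out,ipSIC}(P_s^a)$ converges to a constant as $P_s^a\to\infty$, and the diversity order of $D_n$ with ipSIC is zero, i.e. $$\lim_{P_s^a\to\infty}-\frac{\log P_{D_n}^{out,ipSIC}(P_s^a)}{\log P_s^a}=0.$$
   Context: Parameters: integers $M,N\ge 1$ (numbers of reflecting elements of the active RIS (ARIS) and the passive RIS (PRIS)); ARIS amplification factor $\beta>1$; transmit power $P_s^a>0$; power allocation factors $a_n,a_m>0$ with $a_n+a_m=1$; noise powers $\sigma_a^2,\sigma^2>0$; residual interference power $\Omega_{RI}>0$; Rician factor $\kappa>0$; Nakagami shape parameter $m_{na}>0$ and scale parameter $\Omega_{na}>0$; path loss $\eta>0$, path loss exponent $\alpha>0$, distances $d_{h1},d_{h2},d_{g1},d_{gn}>0$; $\overline{\lambda_n}=\eta^{-4}d_{h1}^{\alpha}d_{h2}^{\alpha}d_{g1}^{\alpha}d_{gn}^{\alpha}$. Target rates $R_n,R_m>0$, thresholds $\gamma_{th_n}=2^{R_n}-1$, $\gamma_{th_m}=2^{R_m}-1$. Channel statistics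 (cascaded Rician and Nakagami-$m$ fading, approximate distributions): let $e_\varphi=\sqrt{\frac{\pi}{4(\kappa+1)}}\,\frac{\Gamma(m_{na}+\frac12)}{\Gamma(m_{na})}\,m_{na}^{-1/2}\,L_{1/2}(-\kappa)$ and $d_\varphi=1-\frac{L_{1/2}^2(-\kappa)}{4(\kappa+1)}\cdot\frac{\pi}{m_{na}}\left(\frac{\Gamma(m_{na}+\frac12)}{\Gamma(m_{na})}\right)^2$, where $L_{1/2}(-\kappa)=e^{-\kappa/2}\left[(1+\kappa)I_0(\kappa/2)+\kappa I_1(\kappa/2)\right]$ with $I_0,I_1$ modified Bessel functions of the first kind. Put $a_X=\frac{Ne_\varphi^2}{d_\varphi}-1$, $a_Y=\frac{Me_\varphi^2}{d_\varphi}-1$, $b_X=b_Y=\frac{d_\varphi}{e_\varphi}$. The cascaded channel gains $\zeta_h,\zeta_g$ are independent positive random variables with densities $f_{\zeta_h}(x)=\frac{x^{(a_X-1)/2}}{2b_X^{a_X+1}\Gamma(a_X+1)}e^{-\sqrt{x}/b_X}$ and $f_{\zeta_g}(y)=\frac{y^{(a_Y-1)/2}}{2b_Y^{a_Y+1}\Gamma(a_Y+1)}e^{-\sqrt{y}/b_Y}$ on $(0,\infty)$. The residual interference gain $|h_{RI}|^2$ is exponential with mean $\Omega_{RI}$ and independent of $(\zeta_h,\zeta_g)$. SINRs (ipSIC): with $W_n=\zeta_h\zeta_g/\overline{\lambda_n}$, $$\gamma_{D_n}^{D_m}=\frac{\beta P_s^aW_na_m}{\beta P_s^aW_na_n+\beta\sigma_a^2M\Omega_{na}+\sigma^2},\qquad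 \gamma_{D_n}=\frac{\beta P_s^aW_na_n}{P_s^a|h_{RI}|^2+\beta\sigma_a^2M\Omega_{na}+\sigma^2}.$$ *)

(* Defs.v *)
From HB Require Import structures.
From mathcomp Require Import all_boot all_order all_algebra.
From mathcomp Require Import all_classical all_reals all_analysis.

Set Implicit Arguments.
Unset Strict Implicit.
Unset Printing Implicit Defensive.

Import Order.TTheory GRing.Theory Num.Theory.
Import numFieldNormedType.Exports.

Local Open Scope classical_set_scope.
Local Open Scope ring_scope.

Section special_functions.
Variable R : realType.
Implicit Types x t : R.

(* Euler's Gamma function; the integral converges for 0 < x, the only case in
   which it is used below. *)
Definition Gamma x : R :=
  \int[lebesgue_measure]_(t in `]0, +oo[) (t `^ (x - 1) * expR (- t)).

(* Modified Bessel function of the first kind, of natural order n. *)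
Definition bessel_I (n : nat) x : R :=
  limn (series (fun k => (x / 2) ^+ (2 * k + n)%N / (k`! * (k + n)`!)%:R)).

(* [laguerre_half k] is L_{1/2}(-k): the sign is built in. *)
Definition laguerre_half k : R :=
  expR (- k / 2) * ((1 + k) * bessel_I 0 (k / 2) + k * bessel_I 1 (k / 2)).

End special_functions.

Section probability_notions.
Context {d : measure_display} {T : measurableType d} {R : realType}.
Variable P : probability T R.

Definition has_density (X : {RV P >-> R}) (f : R -> R) : Prop :=
  forall A : set R, measurable A ->
    distribution P X A = (\int[lebesgue_measure]_(x in A) (f x)%:E)%E.

Definition exponential_with_mean (X : {RV P >-> R}) (mean : R) : Prop :=
  forall A : set R, measurable A ->
    distribution P X A = exponential_prob mean^-1 A.

Definition independent_RV {d1 d2 : measure_display} {T1 : measurableType d1}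
    {T2 : measurableType d2} (X : T -> T1) (Y : T -> T2) : Prop :=
  forall (A : set T1) (B : set T2), measurable A -> measurable B ->
    P (X @^-1` A `&` Y @^-1` B) = (P (X @^-1` A) * P (Y @^-1` B))%E.

End probability_notions.

(* All parameters of the system except the transmit power, which is the
   variable of the asymptotics. *)
Record system (R : realType) := System {
  M : nat;          (* reflecting elements of the ARIS *)
  N : nat;          (* reflecting elements of the PRIS *)
  beta : R;         (* ARIS amplification factor *)
  a_n : R;          (* power allocation factors *)
  a_m : R;
  sigma2_a : R;     (* noise powers sigma_a^2 and sigma^2 *)
  sigma2 : R;
  Omega_RI : R;     (* residual interference power *)
  kappa : R;        (* Rician factor *)
  m_na : R;         (* Nakagami shape *)
  Omega_na : R;     (* Nakagami scale *)
  eta : R;          (* path loss *)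
  alpha : R;        (* path loss exponent *)
  d_h1 : R;         (* distances *)
  d_h2 : R;
  d_g1 : R;
  d_gn : R;
  rate_n : R;       (* target rates R_n and R_m *)
  rate_m : R;
  M_ge1 : (1 <= M)%N;
  N_ge1 : (1 <= N)%N;
  beta_gt1 : 1 < beta;
  a_n_gt0 : 0 < a_n;
  a_m_gt0 : 0 < a_m;
  a_sum1 : a_n + a_m = 1;
  sigma2_a_gt0 : 0 < sigma2_a;
  sigma2_gt0 : 0 < sigma2;
  Omega_RI_gt0 : 0 < Omega_RI;
  kappa_gt0 : 0 < kappa;
  m_na_gt0 : 0 < m_na;
  Omega_na_gt0 : 0 < Omega_na;
  eta_gt0 : 0 < eta;
  alpha_gt0 : 0 < alpha;
  d_h1_gt0 : 0 < d_h1;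
  d_h2_gt0 : 0 < d_h2;
  d_g1_gt0 : 0 < d_g1;
  d_gn_gt0 : 0 < d_gn;
  rate_n_gt0 : 0 < rate_n;
  rate_m_gt0 : 0 < rate_m
}.

Section model.
Context {R : realType}.
Variable S : system R.

Definition lambda_n : R :=
  eta S ^- 4 * d_h1 S `^ alpha S * d_h2 S `^ alpha S
             * d_g1 S `^ alpha S * d_gn S `^ alpha S.

Definition gamma_th_n : R := 2 `^ rate_n S - 1.
Definition gamma_th_m : R := 2 `^ rate_m S - 1.

Definition e_phi : R :=
  Num.sqrt (pi / (4 * (kappa S + 1)))
  * (Gamma (m_na S + 2^-1) / Gamma (m_na S))
  * m_na S `^ (- 2^-1) * laguerre_half (kappa S).

Definition d_phi : R :=
  1 - laguerre_half (kappa S) ^+ 2 / (4 * (kappa S + 1))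
      * (pi / m_na S) * (Gamma (m_na S + 2^-1) / Gamma (m_na S)) ^+ 2.

Definition a_X : R := (N S)%:R * e_phi ^+ 2 / d_phi - 1.
Definition a_Y : R := (M S)%:R * e_phi ^+ 2 / d_phi - 1.
Definition b_X : R := d_phi / e_phi.
Definition b_Y : R := d_phi / e_phi.

Definition cascaded_pdf (a b : R) : R -> R :=
  (fun x => x `^ ((a - 1) / 2) / (2 * b `^ (a + 1) * Gamma (a + 1))
            * expR (- Num.sqrt x / b)) \_ `]0, +oo[.

(* SINRs as functions of the transmit power [Ps] and of the realizations
   [zh], [zg], [g] of the gains zeta_h, zeta_g and |h_RI|^2. *)
Definition W_n (zh zg : R) : R := zh * zg / lambda_n.

Definition sinr_nm (Ps zh zg : R) : R :=
  beta S * Ps * W_n zh zg * a_m S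
  / (beta S * Ps * W_n zh zg * a_n S
     + beta S * sigma2_a S * (M S)%:R * Omega_na S + sigma2 S).

Definition sinr_n (Ps zh zg g : R) : R :=
  beta S * Ps * W_n zh zg * a_n S
  / (Ps * g + beta S * sigma2_a S * (M S)%:R * Omega_na S + sigma2 S).

Context {d : measure_display} {T : measurableType d}.
Variable P : probability T R.
Variables zeta_h zeta_g gain_RI : {RV P >-> R}.

Record channel_model : Prop := ChannelModel {
  zeta_h_gt0 : {ae P, forall w, 0 < zeta_h w};
  zeta_g_gt0 : {ae P, forall w, 0 < zeta_g w};
  zeta_h_density : has_density zeta_h (cascaded_pdf a_X b_X);
  zeta_g_density : has_density zeta_g (cascaded_pdf a_Y b_Y);
  gain_RI_exponential : exponential_with_mean gain_RI (Omega_RI S);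
  zeta_indep : independent_RV P zeta_h zeta_g;
  gain_RI_indep : independent_RV P gain_RI (fun w => (zeta_h w, zeta_g w))
}.

Definition outage_ipSIC (Ps : R) : R :=
  fine (P [set w | sinr_nm Ps (zeta_h w) (zeta_g w) < gamma_th_m])
  + fine (P [set w | gamma_th_m < sinr_nm Ps (zeta_h w) (zeta_g w)
                     /\ sinr_n Ps (zeta_h w) (zeta_g w) (gain_RI w)
                        < gamma_th_n]).

End model.

(* Main.v *)
(* For almost every realization, as the transmit power grows the first outage
   event eventually fails (this is where a_m > gamma_th_m a_n enters), while the
   second one eventually coincides with
     L = {beta W_n a_n <= gamma_th_n |h_RI|^2}.
   By dominated convergence the outage probability tends to P(L).  This floor is
   positive: W_n is bounded by some n with positive probability, and the
   independent exponential gain |h_RI|^2 exceeds any level with positive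
   probability.  Hence ln(outage) stays bounded while ln Ps diverges. *)

Require Import Defs.
From HB Require Import structures.
From mathcomp Require Import all_boot all_order all_algebra.
From mathcomp Require Import all_classical all_reals all_analysis.
From mathcomp Require Import measurable_realfun ring lra.

Set Implicit Arguments.
Unset Strict Implicit.
Unset Printing Implicit Defensive.

Import Order.TTheory GRing.Theory Num.Theory.
Import numFieldNormedType.Exports.

Local Open Scope classical_set_scope.
Local Open Scope ring_scope.

(** * Measurability, limits of probabilities and logarithms *)

Lemma measurable_invr (R : realType) : measurable_fun [set: R] (@GRing.inv R).
Proof.
rewrite -(setvU [set (0:R)]).
apply/measurable_funU; [by apply: measurableC|by []|split].
- apply: subspace_continuous_measurable_fun; first exact: measurableC.
  rewrite continuous_open_subspace; last first.
    by apply: closed_openC; exact: closed_eq.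
  by move=> x; rewrite inE/= => /eqP x0; exact: inv_continuous.
(* Inversion is discontinuous at 0, but constant on the singleton by the convention [0^-1 = 0]. *)
- apply: (eq_measurable_fun (cst (0:R))); last exact: measurable_cst.
  by move=> x; rewrite inE/= => ->; rewrite invr0.
Qed.

(** Dominated convergence for indicators: almost everywhere they are eventually constant in [p], and
    the constant 1 dominates them. Since that theorem concerns sequences, the limit at infinity is
    first tested along every sequence [u] tending to it. *)
Lemma cvg_probability_near_eq (d : measure_display) (T : measurableType d)
    (R : realType) (P : probability T R) (A : R -> set T) (B : set T) :
  (forall p, measurable (A p)) -> measurable B ->
  {ae P, forall w, \forall p \near +oo, A p w <-> B w} ->
  fine (P (A p)) @[p --> +oo] --> fine (P B).
Proof.
move=> mA mB AB; apply/cvg_pinftyP => u uoo.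
apply: fine_cvg; rewrite fineK ?fin_num_measure//.
rewrite -[X in P X]setIT -integral_indic//.
rewrite (_ : (fun n => _) =
  (fun n => \int[P]_x (\1_(A (u n)) x)%:E)%E); last first.
  by apply/funext => n; rewrite integral_indic// setIT.
have [] // := @dominated_convergence _ T R P setT measurableT
  (fun n x => (\1_(A (u n)) x)%:E) (EFin \o \1_B) (cst 1%E).
- by move=> n; apply/measurable_EFinP; exact: measurable_indic.
- by apply/measurable_EFinP; exact: measurable_indic.
- apply: filterS AB => w ABw _; apply: cvg_near_cst.
  have : \forall n \near \oo, A (u n) w <-> B w by exact: (uoo _ ABw).
  apply: filterS => n h; rewrite /= !indicE; congr ((nat_of_bool _)%:R%:E).
  by apply/idP/idP; rewrite !inE h.
- exact: finite_measure_integrable_cst.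
- by apply: nearW => w n _; rewrite gee0_abs ?lee_fin// indicE lern1 leq_b1.
Qed.

Lemma cvgr_ln_pinfty (R : realType) : @ln R x @[x --> +oo] --> +oo.
Proof.
apply/cvgryPge => A; near=> x.
rewrite -(expRK A) ler_ln ?posrE ?expR_gt0//.
Unshelve. all: by end_near. Qed.

Lemma gt1_powRr (R : realType) (a r : R) : 1 < a -> 0 < r -> 1 < a `^ r.
Proof.
move=> a1 r0; have := @gt0_ltr_powR R r r0 1 a.
by rewrite powR1; apply => //; rewrite nnegrE// ltW// (lt_trans _ a1).
Qed.

(** As [c] is positive, [ln] is continuous there and the numerator has a finite limit, while the
    denominator diverges. *)
Lemma cvg_ln_div_ln_pinfty (R : realType) (f : R -> R) (c : R) : 0 < c ->
  f p @[p --> +oo] --> c -> ln (f p) / ln p @[p --> +oo] --> (0 : R).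
Proof.
move=> c0 fc; rewrite -(mulr0 (ln c)); apply: cvgM.
  by apply: (cvg_comp _ _ fc); exact: continuous_ln.
rewrite gtr0_cvgV0; first exact: cvgr_ln_pinfty.
by near=> p; rewrite ln_gt0//; near: p; exact: nbhs_pinfty_gt.
Unshelve. all: by end_near. Qed.

(** * Exponential gain and events of positive probability *)

Section exponential_gain.
Context {d : measure_display} {T : measurableType d} {R : realType}.
Variables (P : probability T R) (X : {RV P >-> R}) (mean : R).
Hypothesis expX : exponential_with_mean X mean.

Lemma exponential_mean_lt0 : P (X @^-1` `]-oo, 0[) = 0%E.
Proof.
have /= := expX (measurable_itv `]-oo, 0[).
rewrite /distribution/= /pushforward => ->.
rewrite /exponential_prob; apply: integral0_eq => x /=.
by rewrite in_itv/= => x0; rewrite lt0_exponential_pdf.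
Qed.

Lemma exponential_mean_ae_ge0 : {ae P, forall w, 0 <= X w}.
Proof.
exists (X @^-1` `]-oo, 0[); split.
- by rewrite -[X in measurable X]setTI; exact: measurable_funPT.
- exact: exponential_mean_lt0.
- by move=> w /=; rewrite in_itv/= => /negP; rewrite -ltNge.
Qed.

(** The closed form of the law on [[0, s]] leaves mass [expR (- mean^-1 * s)] to the complement,
    whose negative part is null; the rest lies above [t] once [t <= s]. *)
Lemma exponential_mean_tail_gt0 (t : R) : (0 < P (X @^-1` `[t, +oo[))%E.
Proof.
have mX A : measurable A -> measurable (X @^-1` A).
  by move=> mA; rewrite -[X in measurable X]setTI; exact: measurable_funPT.
(* Above [t], and strictly positive as the closed form on [[0, s]] requires. *)
pose s := Num.max t 0 + 1.
have s0 : 0 < s by rewrite ltr_pwDr// le_max lexx orbT.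
apply: (@lt_le_trans _ _ (P (~` (X @^-1` `[0, s])))); last first.
  rewrite -[leRHS]adde0 -exponential_mean_lt0.
  apply: (le_trans _ (measureU2 _ _ _)); [|exact: mX..].
  apply: le_measure; rewrite ?inE.
  - by apply: measurableC; exact: mX.
  - by apply: measurableU; exact: mX.
  - move=> w /=; rewrite !in_itv/= andbT => /negP; rewrite negb_and -!ltNge.
    move=> /orP[|sw]; [by right|left].
    rewrite (le_trans _ (ltW sw))// (le_trans (y := Num.max t 0))//.
      by rewrite le_max lexx.
    by rewrite lerDl.
rewrite probability_setC; last exact: mX.
have /= := expX (measurable_itv `[0, s]).
rewrite /distribution/= /pushforward => ->.
rewrite exponential_prob_itv0c//.
set r := expR _; change (0%:E < (1 - (1 - r))%:E)%E.
by rewrite lte_fin opprB addrCA subrr addr0 expR_gt0.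
Qed.

End exponential_gain.

(** The sublevel sets at natural levels exhaust the space; were all of them null, so would be their
    union, which has mass 1. *)
Lemma probability_le_nat_gt0 (d : measure_display) (T : measurableType d)
    (R : realType) (P : probability T R) (Y : T -> R) :
  measurable_fun setT Y ->
  exists n : nat, (0 < P [set w | (Y w <= n%:R)%R])%E.
Proof.
move=> mY; apply: contrapT => /forallNP H.
pose F n := [set w | Y w <= n%:R].
have mF n : measurable (F n).
  rewrite (_ : F n = Y @^-1` `]-oo, n%:R]); last first.
    by apply/seteqP; split=> w /=; rewrite in_itv.
  by rewrite -[X in measurable X]setTI; exact: mY.
have UF : \bigcup_n F n = setT.
  apply/seteqP; split => // w _; exists (Num.truncn (Y w)).+1 => //=.
  by rewrite /F/= ltW// truncnS_gt.
have : P (\bigcup_n F n) = 0%E.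
  apply/negligibleP; first exact: bigcup_measurable.
  apply: negligible_bigcup => n; apply/negligibleP => //.
  apply/eqP; rewrite eq_le measure_ge0 andbT leNgt; apply/negP; exact: H.
by rewrite UF probability_setT => -[/eqP]; rewrite oner_eq0.
Qed.

(** * Behaviour of the SINRs at high transmit power, for fixed gains *)

Section outage.
Context {R : realType}.
Variable S : system R.

Lemma gamma_th_n_gt0 : 0 < gamma_th_n S.
Proof. by rewrite subr_gt0 gt1_powRr ?ltr1n ?rate_n_gt0. Qed.

Lemma beta_gt0 : 0 < beta S.
Proof. exact: lt_trans (beta_gt1 S). Qed.

Lemma lambda_n_gt0 : 0 < lambda_n S.
Proof.
have pow_gt0 x : 0 < x -> 0 < x `^ alpha S by exact: powR_gt0.
by rewrite !mulr_gt0 ?pow_gt0 ?invr_gt0 ?exprn_gt0 ?eta_gt0 ?d_h1_gt0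
  ?d_h2_gt0 ?d_g1_gt0 ?d_gn_gt0.
Qed.

(** The part of both denominators that is free of [Ps]. Isolating it makes numerators and
    denominators visibly affine in [Ps]. *)
Let noise : R := beta S * sigma2_a S * (M S)%:R * Omega_na S + sigma2 S.

Lemma noise_gt0 : 0 < noise.
Proof.
rewrite /noise ltr_wpDl ?sigma2_gt0// !mulr_ge0//.
- exact/ltW/beta_gt0.
- exact/ltW/sigma2_a_gt0.
- exact/ltW/Omega_na_gt0.
Qed.

Lemma sinr_nmE Ps zh zg : sinr_nm S Ps zh zg =
  Ps * (beta S * W_n S zh zg * a_m S)
  / (Ps * (beta S * W_n S zh zg * a_n S) + noise).
Proof. by rewrite /sinr_nm /noise addrA; congr (_ / _); ring. Qed.

Lemma sinr_nE Ps zh zg g : sinr_n S Ps zh zg g =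
  Ps * (beta S * W_n S zh zg * a_n S) / (Ps * g + noise).
Proof. by rewrite /sinr_n /noise addrA; congr (_ / _); ring. Qed.

(** Clearing the positive denominator leaves an affine inequality in [Ps], whose slope
    [x * (a_m S - gamma_th_m S * a_n S)] is positive. *)
Lemma near_sinr_nm_gt zh zg : gamma_th_m S * a_n S < a_m S ->
  0 < W_n S zh zg -> \forall Ps \near +oo, gamma_th_m S < sinr_nm S Ps zh zg.
Proof.
move=> ha W0; pose x := beta S * W_n S zh zg.
have x0 : 0 < x by rewrite mulr_gt0// beta_gt0.
have c0 : 0 < x * (a_m S - gamma_th_m S * a_n S) by rewrite mulr_gt0// subr_gt0.
near=> Ps.
have Ps0 : 0 < Ps by near: Ps; apply: nbhs_pinfty_gt; exact: num_real.
have PsK : gamma_th_m S * noise / (x * (a_m S - gamma_th_m S * a_n S)) < Ps.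
  by near: Ps; apply: nbhs_pinfty_gt; exact: num_real.
rewrite sinr_nmE -/x ltr_pdivlMr; last first.
  by rewrite ltr_wpDl ?noise_gt0// mulr_ge0 ?ltW// mulr_gt0 ?a_n_gt0.
move: PsK; rewrite ltr_pdivrMr// => PsK; lra.
Unshelve. all: by end_near. Qed.

(** Clearing the denominator gives [Ps * (x - gamma_th_n S * g) < gamma_th_n S * noise]. It holds
    for all positive [Ps] when the slope is nonpositive and fails for large [Ps] otherwise. A zero
    slope falls on the outage side because the noise is positive, whence the non-strict
    inequality. *)
Lemma near_sinr_n_lt zh zg g : 0 < W_n S zh zg -> 0 <= g ->
  \forall Ps \near +oo, sinr_n S Ps zh zg g < gamma_th_n S <->
    beta S * W_n S zh zg * a_n S <= gamma_th_n S * g.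
Proof.
move=> W0 g0; set x := beta S * W_n S zh zg * a_n S.
have thK : 0 < gamma_th_n S * noise.
  by rewrite mulr_gt0 ?gamma_th_n_gt0 ?noise_gt0.
near=> Ps.
have Ps0 : 0 < Ps by near: Ps; apply: nbhs_pinfty_gt; exact: num_real.
rewrite sinr_nE -/x ltr_pdivrMr; last first.
  by rewrite ltr_wpDl ?noise_gt0// mulr_ge0// ltW.
have [xg|gx] := leP x (gamma_th_n S * g).
  split=> // _.
  have := ler_wpM2l (ltW Ps0) xg; lra.
split=> // h; exfalso; move: h; apply/negP; rewrite -leNgt.
have c0 : 0 < x - gamma_th_n S * g by rewrite subr_gt0.
have : gamma_th_n S * noise / (x - gamma_th_n S * g) < Ps.
  by near: Ps; apply: nbhs_pinfty_gt; exact: num_real.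
rewrite ltr_pdivrMr// => PsK; lra.
Unshelve. all: by end_near. Qed.

(** * The outage floor: convergence and positivity *)

Context {d : measure_display} {T : measurableType d}.
Variable P : probability T R.
Variables zeta_h zeta_g gain_RI : {RV P >-> R}.
Hypothesis hchannel : channel_model S zeta_h zeta_g gain_RI.

Let W w := W_n S (zeta_h w) (zeta_g w).

Let measurable_lt (f g : T -> R) : measurable_fun setT f ->
  measurable_fun setT g -> measurable [set w | f w < g w].
Proof.
move=> mf mg; rewrite -[X in measurable X]setTI.
exact: (measurable_fun_ltr mf mg measurableT (Y := [set true])).
Qed.

Let measurable_le (f g : T -> R) : measurable_fun setT f ->
  measurable_fun setT g -> measurable [set w | f w <= g w].
Proof.
move=> mf mg; rewrite -[X in measurable X]setTI.
exact: (measurable_fun_ler mf mg measurableT (Y := [set true])).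
Qed.

Lemma measurable_W_n : measurable_fun setT W.
Proof. by apply: measurable_funM => //; exact: measurable_funM. Qed.

Lemma measurable_sinr_nm Ps :
  measurable_fun setT (fun w => sinr_nm S Ps (zeta_h w) (zeta_g w)).
Proof.
under eq_fun do rewrite sinr_nmE.
have mW a : measurable_fun setT (fun w => Ps * (beta S * W w * a)).
  apply: measurable_funM => //; apply: measurable_funM => //.
  by apply: measurable_funM => //; exact: measurable_W_n.
apply: measurable_funM => //.
apply: (measurableT_comp (@measurable_invr R)).
exact: measurable_funD.
Qed.

Lemma measurable_sinr_n Ps : measurable_fun setT
  (fun w => sinr_n S Ps (zeta_h w) (zeta_g w) (gain_RI w)).
Proof.
under eq_fun do rewrite sinr_nE.
apply: measurable_funM.
  apply: measurable_funM => //; apply: measurable_funM => //.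
  by apply: measurable_funM => //; exact: measurable_W_n.
apply: (measurableT_comp (@measurable_invr R)).
by apply: measurable_funD => //; exact: measurable_funM.
Qed.

Definition limit_outage : set T :=
  [set w | beta S * W w * a_n S <= gamma_th_n S * gain_RI w].

Lemma measurable_limit_outage : measurable limit_outage.
Proof.
apply: measurable_le; last exact: measurable_funM.
by apply: measurable_funM => //; apply: measurable_funM => //;
  exact: measurable_W_n.
Qed.

Lemma ae_W_n_gt0 : {ae P, forall w, 0 < W w}.
Proof.
apply: filterS2 (zeta_h_gt0 hchannel) (zeta_g_gt0 hchannel) => w h g.
by rewrite divr_gt0 ?lambda_n_gt0// mulr_gt0.
Qed.

Lemma outage_ipSIC_cvg : gamma_th_m S * a_n S < a_m S ->
  outage_ipSIC S zeta_h zeta_g gain_RI Ps @[Ps --> +oo]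
  --> fine (P limit_outage).
Proof.
move=> ha; rewrite -[fine (P limit_outage)]add0r; apply: cvgD.
  (* The first outage event fails eventually, so its limit event is empty. *)
  rewrite (_ : 0 = fine (P set0)); last by rewrite measure0.
  apply: cvg_probability_near_eq => //.
    by move=> Ps; apply: measurable_lt => //; exact: measurable_sinr_nm.
  apply: filterS ae_W_n_gt0 => w W0.
  apply: filterS (near_sinr_nm_gt ha W0) => Ps.
  by move=> lt; split => //= /lt_trans -/(_ _ lt); rewrite ltxx.
apply: cvg_probability_near_eq.
- move=> Ps; apply: measurableI; apply: measurable_lt => //.
    exact: measurable_sinr_nm.
  exact: measurable_sinr_n.
- exact: measurable_limit_outage.
- apply: filterS2 ae_W_n_gt0
    (exponential_mean_ae_ge0 (gain_RI_exponential hchannel)) => w W0 g0.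
  (* The first conjunct of the second event is eventually true, so only the comparison for [sinr_n]
     survives. *)
  apply: filterS2 (near_sinr_nm_gt ha W0) (near_sinr_n_lt W0 g0) => Ps h1 h2.
  by rewrite /limit_outage/= -h2; split=> [[]|].
Qed.

Lemma limit_outage_gt0 : (0 < P limit_outage)%E.
Proof.
have [n Wn] := probability_le_nat_gt0 P measurable_W_n.
(* The gain level at which [W_n = n] gives equality in [limit_outage]; a larger gain and a smaller
   [W_n] stay inside the event. *)
pose t : R := beta S * n%:R * a_n S / gamma_th_n S.
(* The bound on [W_n] is phrased on pairs because [gain_RI] is independent of the pair of cascaded
   gains. *)
pose E : set (R * R) := [set z | W_n S z.1 z.2 <= n%:R].
have mE : measurable E.
  rewrite (_ : E = (fun z => W_n S z.1 z.2) @^-1` `]-oo, n%:R]); last first.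
    by apply/seteqP; split=> z /=; rewrite in_itv.
  rewrite -[X in measurable X]setTI.
  by apply: measurable_funM => //; apply: measurable_funM.
have := gain_RI_indep hchannel (measurable_itv `[t, +oo[) mE.
have /= Pg := exponential_mean_tail_gt0 (gain_RI_exponential hchannel) t.
move=> /= PE; apply: (lt_le_trans (mule_gt0 Pg Wn)).
rewrite -PE; apply: le_measure; rewrite ?inE.
- apply: measurableI; last exact: measurable_le measurable_W_n _.
  by rewrite -[X in measurable X]setTI; exact: measurable_funPT.
- exact: measurable_limit_outage.
- move=> w [/=]; rewrite in_itv/= andbT ler_pdivrMr ?gamma_th_n_gt0// => tg Wle.
  rewrite /limit_outage/= [leRHS]mulrC; apply: le_trans tg.
  by rewrite ler_pM2r ?a_n_gt0// ler_pM2l ?beta_gt0.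
Qed.

End outage.

(** * Zero diversity order *)

Theorem mainTheorem6 (R : realType) (S : system R)
    (d : measure_display) (T : measurableType d) (P : probability T R)
    (zeta_h zeta_g gain_RI : {RV P >-> R})
    (hchannel : channel_model S zeta_h zeta_g gain_RI)
    (ha : gamma_th_m S * a_n S < a_m S) :
  (exists c : R,
     outage_ipSIC S zeta_h zeta_g gain_RI Ps @[Ps --> +oo] --> c) /\
  - (ln (outage_ipSIC S zeta_h zeta_g gain_RI Ps) / ln Ps)
    @[Ps --> +oo] --> (0 : R).
Proof.
have outc := outage_ipSIC_cvg hchannel ha.
split; first by eexists; exact: outc.
rewrite -oppr0; apply: cvgN; apply: (cvg_ln_div_ln_pinfty _ outc).
(* What remains is that the floor, read as a real number, is positive. *)
rewrite fine_gt0// limit_outage_gt0//= ltey_eq fin_num_measure//.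
exact: measurable_limit_outage.
Qed.
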